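(* Let $(Q,P)$ be a weakly quasi-lattice ordered group, and let $\Lambda$ be a finitely aligned $P$-graph. Let $X_{\Lambda,\mathrm m}$ be the path space of graph morphisms and $X_{\Lambda,\mathrm f}$ the path space of filters of $\Lambda$, each with its topology and its partial action of $P$. Then the map $$h\colon X_{\Lambda,\mathrm m}\to X_{\Lambda,\mathrm f},\qquad x\mapsto h(x):=x(e\,\mathrm{dom}(x)),$$ where $e\,\mathrm{dom}(x)=\{(p,q)\in\mathrm{dom}(x) : p=e\}$, is a conjugacy from $(X_{\Lambda,\mathrm m},P,T_{X_{\Lambda,\mathrm m}})$ to $(X_{\Lambda,\mathrm f},P,T_{X_{\Lambda,\mathrm f}})$.
   Context: Weakly quasi-lattice ordered groups. Let $Q$ be a discrete group and $P\subseteq Q$ a submonoid with $P\cap P^{-1}=\{e\}$. For $p,r\in P$ write $p\le r$ if $pq=r$ for some $q\in P$; this is a left-invariant partial order. $(Q,P)$ is weakly quasi-lattice ordered if any two elements of $P$ with a common upper bound have a least common upper bound. $P$-graphs. A $P$-graph is a countable small category $\Lambda$ (identified with its set of morphisms; composable pairs $\Lambda^{(2)}$, units $\Lambda^{(0)}$, range $\mathbf r$, source $\mathbf s$, $\lambda\mu$ defined iff $\mathbf s(\lambda)=\mathbf r(\mu)$) with a functor $\mathbf d\colon\Lambda\to P$ satisfying unique factorisation: if $\mathbf d(\lambda)=pq$ with $p,q\in P$, there are unique $\mu,\nu\in\Lambda$ with $\lambda=\mu\nu$, $\mathbf d(\mu)=p$, $\mathbf d(\nu)=q$. Write $\Lambda^p=\mathbf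 d^{-1}(p)$ and $\mu\Lambda=\{\mu\nu : \mathbf s(\mu)=\mathbf r(\nu)\}$. $\Lambda$ is finitely aligned if for all $\mu,\nu\in\Lambda$ there is a finite $J\subseteq\Lambda$ with $\mu\Lambda\cap\nu\Lambda=\bigcup_{\lambda\in J}\lambda\Lambda$. Write $\mu\preceq\lambda$ if $\lambda\in\mu\Lambda$ (a partial order). A graph morphism is a degree-preserving functor. Path prototypes. For $m\in P$, $\Omega_{P,m}=\{(p,q)\in P\times P : p\le q\le m\}$, where $(p,q),(q',r)$ are composable iff $q=q'$, $(p,q)(q,r)=(p,r)$, and $\mathbf d(p,q)=p^{-1}q$. A sequence $(m_n)\subseteq P$ is $\le$-increasing if $m_j\le m_k$ whenever $j<k$; then $\Omega_{P,(m_n)}=\bigcup_n\Omega_{P,m_n}$ with the evident category structure and degree functor. Graph morphism path space. $X_{\Lambda,\mathrm m}$ is the set of graph morphisms $x\colon\Omega_{P,(m_n)}\to\Lambda$ with $(m_n)\subseteq P$ $\le$-increasing; $\mathrm{dom}(x)$ denotes the domain of $x$. Its topology has as basis the sets $\{x : K_1\subseteq x(e\,\mathrm{dom}(x))\subseteq\Lambda\setminus K_2\}$ with $K_1,K_2\subseteq\Lambda$ finite (possibly empty). The action of $P$: $X_{\Lambda,\mathrm m}*P=\{(x,m) : (e,m)\in\mathrm{dom}(x)\}$, and $x\cdot m$ is the graph morphism with $(p,q)\in\mathrm{dom}(x\cdot m)\iff(mp,mq)\in\mathrm{dom}(x)$ and $(x\cdot m)(p,q)=x(mp,mq)$. Filter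 path space. A filter of $\Lambda$ is a nonempty $x\subseteq\Lambda$ that is hereditary ($\lambda\preceq\mu\in x$ implies $\lambda\in x$) and directed ($\mu,\nu\in x$ implies there is $\lambda\in x$ with $\mu,\nu\preceq\lambda$). $X_{\Lambda,\mathrm f}$ is the set of filters, with topology having as basis the sets $\{x : K_1\subseteq x\subseteq\Lambda\setminus K_2\}$ with $K_1,K_2\subseteq\Lambda$ finite (possibly empty). For each filter $x$, $\mathbf d|_x$ is injective. The action of $P$: $X_{\Lambda,\mathrm f}*P=\{(x,m) : x\cap\Lambda^m\ne\emptyset\}$ and $x\cdot m=\{\nu\in\Lambda : \mu\nu\in x\}$, where $\mu$ is the unique element of $x\cap\Lambda^m$. Both are (partial) monoid actions. For a partial monoid action of $P$ on $X$ with domain $X*P\subseteq X\times P$, write $\mathrm{dom}_X(m)=\{x\in X : (x,m)\in X*P\}$. A conjugacy between actions of $P$ on topological spaces $X$ and $Y$ is a map $h\colon X\to Y$ such that (C1) $h$ is a homeomorphism; (C2) $h(\mathrm{dom}_X(m))=\mathrm{dom}_Y(m)$ for all $m\in P$; (C3) $h(x\cdot m)=h(x)\cdot m$ for all $m\in P$, $x\in\mathrm{dom}_X(m)$. *)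

(* Defs.v *)
From HB Require Import structures.
From mathcomp Require Import all_boot.
From mathcomp Require Import all_classical.
From mathcomp Require Import topology.

Set Implicit Arguments.
Unset Strict Implicit.
Unset Printing Implicit Defensive.

Local Open Scope classical_set_scope.
Local Open Scope group_scope.

(* A submonoid P of Q is an [umagmaClosed Q]: a predicate on Q that contains 1
   and is closed under multiplication. *)

Definition ple (Q : groupType) (P : umagmaClosed Q) (p r : Q) : Prop :=
  exists2 q, q \in P & p * q = r.

Definition weakly_quasi_lattice_ordered (Q : groupType) (P : umagmaClosed Q) :
    Prop :=
  (forall p, p \in P -> p^-1 \in P -> p = 1) /\
  (forall p q, p \in P -> q \in P ->
     (exists r, [/\ r \in P, ple P p r & ple P q r]) ->
     exists r, [/\ r \in P, ple P p r, ple P q r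
       & forall t, t \in P -> ple P p t -> ple P q t -> ple P r t]).

(* A small category, identified with its set of morphisms, together with a
   functor [deg] to the submonoid P (seen as a category with one object).
   The composite [comp H] of [l] and [m] takes a proof of [src l = rng m]. *)
Record graded_category (Q : groupType) (P : umagmaClosed Q) :=
  GradedCategory {
  mor :> Type;
  rng : mor -> mor;
  src : mor -> mor;
  comp : forall l m : mor, src l = rng m -> mor;
  deg : mor -> Q;
  rng_rng : forall l, rng (rng l) = rng l;
  src_rng : forall l, src (rng l) = rng l;
  rng_src : forall l, rng (src l) = src l;
  src_src : forall l, src (src l) = src l;
  rng_comp : forall l m (H : src l = rng m), rng (comp H) = rng l;
  src_comp : forall l m (H : src l = rng m), src (comp H) = src m;
  comp_rng : forall l (H : src (rng l) = rng l), comp H = l;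
  comp_src : forall l (H : src l = rng (src l)), comp H = l;
  comp_assoc : forall l m n (H1 : src l = rng m) (H2 : src m = rng n)
    (H3 : src (comp H1) = rng n) (H4 : src l = rng (comp H2)),
    comp H3 = comp H4;
  deg_in : forall l, deg l \in P;
  deg_rng : forall l, deg (rng l) = 1;
  deg_comp : forall l m (H : src l = rng m), deg (comp H) = deg l * deg m
}.

Definition is_comp (Q : groupType) (P : umagmaClosed Q)
    (C : graded_category P) (m n l : C) : Prop :=
  exists H : src m = rng n, comp H = l.

Definition unique_factorisation (Q : groupType) (P : umagmaClosed Q)
    (C : graded_category P) : Prop :=
  forall (l : C) (p q : Q), p \in P -> q \in P -> deg l = p * q ->
    exists! mn : C * C, [/\ is_comp mn.1 mn.2 l, deg mn.1 = p & deg mn.2 = q].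

Record Pgraph (Q : groupType) (P : umagmaClosed Q) := PGraph {
  pgraph_cat :> graded_category P;
  pgraph_countable : countable [set: pgraph_cat];
  pgraph_uf : unique_factorisation pgraph_cat
}.

Definition right_ideal (Q : groupType) (P : umagmaClosed Q)
    (C : graded_category P) (m : C) : set C :=
  [set l | exists n, is_comp m n l].

Definition finitely_aligned (Q : groupType) (P : umagmaClosed Q)
    (C : graded_category P) : Prop :=
  forall m n : C, exists2 J : set C, finite_set J &
    right_ideal m `&` right_ideal n = \bigcup_(l in J) right_ideal l.

Definition preceq (Q : groupType) (P : umagmaClosed Q)
    (C : graded_category P) (m l : C) : Prop := right_ideal m l.

Record graph_morphism (Q : groupType) (P : umagmaClosed Q)
    (C D : graded_category P) (f : C -> D) : Prop := GraphMorphism {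
  gm_rng : forall l, f (rng l) = rng (f l);
  gm_src : forall l, f (src l) = src (f l);
  gm_comp : forall l m (H : src l = rng m) (H' : src (f l) = rng (f m)),
    f (comp H) = comp H';
  gm_deg : forall l, deg (f l) = deg l
}.

Section PathPrototype.
Variables (Q : groupType) (P : umagmaClosed Q) (m : nat -> Q).

Definition Omega_set : set (Q * Q) :=
  [set pq | [/\ pq.1 \in P, pq.2 \in P, ple P pq.1 pq.2
              & exists n, ple P pq.2 (m n)]].

Definition Omega_mor := {pq : Q * Q | Omega_set pq}.

Lemma ple_refl p : ple P p p.
Proof. by exists 1; [exact: gpred1 | rewrite mulg1]. Qed.

Lemma ple_trans q p r : ple P p q -> ple P q r -> ple P p r.
Proof.
move=> [a aP <-] [b bP <-].
by exists (a * b); [exact: gpredM | rewrite mulgA].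
Qed.

Lemma ple_mul2l a p q : ple P (a * p) (a * q) <-> ple P p q.
Proof.
split=> -[b bP e]; exists b => //; last by rewrite -mulgA e.
by apply: (mulgI a); rewrite mulgA.
Qed.

Lemma Omega_eq (a b : Omega_mor) : sval a = sval b -> a = b.
Proof. by case: a b => a ha [b hb] /= e; exact: eq_exist. Qed.

Lemma Omega_rng_subproof (w : Omega_mor) :
  Omega_set ((sval w).1, (sval w).1).
Proof.
case: w => -[p q] /= [pP qP pq [n qn]]; split=> //=; first exact: ple_refl.
by exists n; exact: ple_trans qn.
Qed.

Lemma Omega_src_subproof (w : Omega_mor) :
  Omega_set ((sval w).2, (sval w).2).
Proof.
case: w => -[p q] /= [pP qP pq [n qn]]; split=> //=; first exact: ple_refl.
by exists n.
Qed.

Definition Omega_rng (w : Omega_mor) : Omega_mor :=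
  exist _ _ (Omega_rng_subproof w).
Definition Omega_src (w : Omega_mor) : Omega_mor :=
  exist _ _ (Omega_src_subproof w).

Lemma Omega_comp_subproof (v w : Omega_mor) :
  Omega_src v = Omega_rng w -> Omega_set ((sval v).1, (sval w).2).
Proof.
case: v w => -[p q] /= hv [[q' r] /= hw] -[] qq' _; subst q'.
case: hv hw => /= pP qP pq _ [/= _ rP qr rn]; split=> //=.
exact: ple_trans qr.
Qed.

Definition Omega_comp (v w : Omega_mor) (H : Omega_src v = Omega_rng w) :
  Omega_mor := exist _ _ (Omega_comp_subproof H).

Definition Omega_deg (w : Omega_mor) : Q := (sval w).1^-1 * (sval w).2.

Program Definition Omega : graded_category P :=
  @GradedCategory Q P Omega_mor Omega_rng Omega_src Omega_comp Omega_deg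
    _ _ _ _ _ _ _ _ _ _ _ _.
Next Obligation. by move=> l; exact: Omega_eq. Qed.
Next Obligation. by move=> l; exact: Omega_eq. Qed.
Next Obligation. by move=> l; exact: Omega_eq. Qed.
Next Obligation. by move=> l; exact: Omega_eq. Qed.
Next Obligation. by move=> l k H; exact: Omega_eq. Qed.
Next Obligation. by move=> l k H; exact: Omega_eq. Qed.
Next Obligation.
by move=> l H; apply: Omega_eq; case: l H => -[].
Qed.
Next Obligation.
by move=> l H; apply: Omega_eq; case: l H => -[].
Qed.
Next Obligation. by move=> *; exact: Omega_eq. Qed.
Next Obligation.
by case=> -[p q] h; rewrite /Omega_deg /=; case: h => _ _ [a aP /= <-] _;
  rewrite mulKg.
Qed.
Next Obligation. by move=> l; rewrite /Omega_deg /= mulVg. Qed.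
Next Obligation.
move=> [[p q] hv] [[q' r] hw] H; rewrite /Omega_deg /=.
by case: H => ->; rewrite -mulgA mulVKg.
Qed.

End PathPrototype.

(* [adom m] is the set of all x such that x.m is defined. *)
Record partial_action (Q : groupType) (P : umagmaClosed Q) (X : Type) :=
  PartialAction {
  adom : Q -> set X;
  act : forall (m : Q) (x : X), adom m x -> X;
  adom_in : forall m x, adom m x -> m \in P;
  adom1 : forall x, adom 1 x;
  act1 : forall x (H : adom 1 x), act H = x;
  adomM : forall m n x, m \in P -> n \in P ->
    adom (m * n) x <-> exists H : adom m x, adom n (act H);
  actM : forall m n x (H : adom m x) (H' : adom n (act H))
    (H'' : adom (m * n) x), act H'' = act H'
}.

Definition homeomorphism (X Y : topologicalType) (h : X -> Y) : Prop :=
  exists g : Y -> X,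
    [/\ cancel h g, cancel g h, continuous h & continuous g].

(* In the last clause, the second clause provides the proofs [Hy]. *)
Definition conjugacy (Q : groupType) (P : umagmaClosed Q)
    (X Y : topologicalType) (TX : partial_action P X)
    (TY : partial_action P Y) (h : X -> Y) : Prop :=
  [/\ homeomorphism h,
      forall m, m \in P -> h @` adom TX m = adom TY m
    & forall m x (Hx : adom TX m x) (Hy : adom TY m (h x)), m \in P ->
        h (act Hx) = act Hy].

Section MorphismPaths.
Variables (Q : groupType) (P : umagmaClosed Q) (C : Pgraph P).

(* A graph morphism with a domain [Omega P m] is encoded as the partial function
   on Q * Q that is [Some] exactly on [Omega_set P m]. Morphisms are then equal
   if and only if they have the same domain and the same values, even if they
   come from different sequences. *)
Definition is_morphism_path (x : Q * Q -> option C) : Prop :=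
  exists m : nat -> Q,
    [/\ forall n, m n \in P,
        forall j k, (j < k)%N -> ple P (m j) (m k)
      & exists2 f : Omega P m -> C, graph_morphism f &
          (forall w : Omega_mor P m, x (sval w) = Some (f w)) /\
          (forall pq, ~ Omega_set P m pq -> x pq = None)].

Record morphism_path := MorphismPath {
  mpath_fun :> Q * Q -> option C;
  mpathP : is_morphism_path mpath_fun
}.

Lemma mpath_eq (x y : morphism_path) : x =1 y -> x = y.
Proof.
case: x y => x hx [y hy] /= /funext e; subst y.
by rewrite (Prop_irrelevance hx hy).
Qed.

Definition mpath_dom (x : morphism_path) : set (Q * Q) :=
  [set pq | x pq <> None].

Definition mpath_edom (x : morphism_path) : set (Q * Q) :=
  [set pq | mpath_dom x pq /\ pq.1 = 1].

Definition mpath_eimage (x : morphism_path) : set C :=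
  [set l | exists2 pq, mpath_edom x pq & x pq = Some l].

Definition mpath_basic (K : set C * set C) : set morphism_path :=
  [set x | K.1 `<=` mpath_eimage x /\ mpath_eimage x `<=` ~` K.2].

HB.instance Definition _ := gen_eqMixin morphism_path.
HB.instance Definition _ := gen_choiceMixin morphism_path.

Let D : set (set C * set C) := [set K | finite_set K.1 /\ finite_set K.2].

Let mpath_basic_cover : \bigcup_(K in D) mpath_basic K = setT.
Proof.
apply/seteqP; split=> // x _; exists (set0, set0); first by split.
by split=> // l _ [].
Qed.

Let mpath_basic_join K L x : D K -> D L -> mpath_basic K x ->
  mpath_basic L x ->
  exists M, [/\ D M, mpath_basic M x
              & mpath_basic M `<=` mpath_basic K `&` mpath_basic L].
Proof.
move=> [K1 K2] [L1 L2] [xK1 xK2] [xL1 xL2].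
exists (K.1 `|` L.1, K.2 `|` L.2); split.
- by split; rewrite /= finite_setU.
- split=> /= [l [/xK1|/xL1] //|l xl [|]]; [exact: xK2 | exact: xL2].
- move=> y [/= y1 y2]; split; split=> l.
  + by move=> ?; apply: y1; left.
  + by move=> /y2 h ?; apply: h; left.
  + by move=> ?; apply: y1; right.
  + by move=> /y2 h ?; apply: h; right.
Qed.

HB.instance Definition _ :=
  isBaseTopological.Build morphism_path mpath_basic_cover mpath_basic_join.

Definition mpath_adom (m : Q) : set morphism_path :=
  [set x | mpath_dom x (1, m)].

Definition mpath_shift (m : Q) (x : morphism_path) (pq : Q * Q) : option C :=
  if (pq.1 \in P) && (pq.2 \in P) then x (m * pq.1, m * pq.2) else None.

Lemma mpath_dom_sub (x : morphism_path) pq : mpath_dom x pq ->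
  [/\ pq.1 \in P, pq.2 \in P & ple P pq.1 pq.2].
Proof.
case: (mpathP x) => m [mP mI [f fm [xf x0]]] xpq.
by have [[]|/x0] := pselect (Omega_set P m pq).
Qed.

Lemma mpath_shift_subproof m x :
  mpath_adom m x -> is_morphism_path (mpath_shift m x).
Proof.
case: (mpathP x) => s [sP sI [f [fr fs fc fd] [xf x0]]] xm.
have [|/x0//] := pselect (Omega_set P s (1, m)).
move=> [_ /= mP _ [k mk]].
have sI' i j : (i <= j)%N -> ple P (s i) (s j).
  rewrite leq_eqVlt => /orP[/eqP->|/sI//]; exact: ple_refl.
pose t n := m^-1 * s (k + n)%N.
have tP n : t n \in P.
  have [b bP e] := ple_trans mk (sI' _ _ (leq_addr n k)).
  by rewrite /t -e mulKg.
have Ht p q : p \in P -> q \in P ->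
    Omega_set P t (p, q) <-> Omega_set P s (m * p, m * q).
  move=> pP qP; split=> -[/= _ _ pq [n qn]]; split=> //=.
  + exact: gpredM.
  + exact: gpredM.
  + exact/ple_mul2l.
  + by exists (k + n)%N; move/(ple_mul2l _ m): qn; rewrite /t mulVKg.
  + exact/(ple_mul2l _ m).
  + exists n; apply/(ple_mul2l _ m); rewrite /t mulVKg.
    exact: ple_trans qn (sI' _ _ (leq_addl _ _)).
have Hw (w : Omega_mor P t) :
    Omega_set P s (m * (sval w).1, m * (sval w).2).
  by case: w => -[p q] /= h; apply/Ht => //; case: h.
pose g (w : Omega_mor P t) : Omega P s := exist _ _ (Hw w).
exists t; split=> //.
  move=> i j ij; apply/(ple_mul2l _ m); rewrite /t !mulVKg.
  by apply: sI; rewrite ltn_add2l.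
exists (fun w => f (g w)).
  have gr (w : Omega P t) : g (rng w) = rng (g w) by exact: Omega_eq.
  have gs (w : Omega P t) : g (src w) = src (g w) by exact: Omega_eq.
  split=> [w|w|v w H H'|w].
  - by rewrite -fr gr.
  - by rewrite -fs gs.
  - have H2 : src (g v) = rng (g w) by rewrite -gr -gs H.
    rewrite -(fc _ _ H2); congr f; exact: Omega_eq.
  - by rewrite fd /= /Omega_deg /= invgM -mulgA mulKg.
split.
  move=> w; rewrite -(xf (g w)) /mpath_shift /=.
  by case: w => -[p q] /= [/= -> ->].
move=> [p q] npq; rewrite /mpath_shift /=.
by case: ifP => // /andP[pP qP]; apply: x0 => /Ht -/(_ pP qP).
Qed.

Definition mpath_act (m : Q) (x : morphism_path) (H : mpath_adom m x) :
  morphism_path := MorphismPath (mpath_shift_subproof H).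

Program Definition mpath_action : partial_action P morphism_path :=
  @PartialAction Q P morphism_path mpath_adom mpath_act _ _ _ _ _.
Next Obligation. by move=> m x /mpath_dom_sub[]. Qed.
Next Obligation.
move=> x; rewrite /mpath_adom /mpath_dom /=.
case: (mpathP x) => s [sP sI [f _ [xf _]]].
have H : Omega_set P s (1, 1).
  split; rewrite /= ?gpred1//; first exact: ple_refl.
  by exists 0%N; exists (s 0%N); rewrite ?mul1g.
by rewrite (xf (exist _ _ H)).
Qed.
Next Obligation.
move=> x H; apply: mpath_eq => -[p q] /=; rewrite /mpath_shift /= !mul1g.
case: ifPn => // /negP npq; apply/esym; apply: contrapT => h; apply: npq.
by have [/= -> ->] := mpath_dom_sub h.
Qed.
Next Obligation.
move=> m n x mP nP.
have dom1 (a b c : Q) : ple P b c -> ple P a b -> a \in P -> b \in P ->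
    mpath_dom x (a, c) -> mpath_dom x (a, b) /\ mpath_dom x (b, c).
  rewrite /mpath_dom /=; case: (mpathP x) => s [sP sI [f _ [xf x0]]].
  move=> bc ab aP bP xac.
  have [|/x0//] := pselect (Omega_set P s (a, c)) => -[/= _ cP _ [k ck]].
  have Hab : Omega_set P s (a, b).
    by split=> //; exists k; exact: ple_trans ck.
  have Hbc : Omega_set P s (b, c) by split=> //; exists k.
  by rewrite (xf (exist _ _ Hab)) (xf (exist _ _ Hbc)).
have dom2 (a b c : Q) : mpath_dom x (a, b) -> mpath_dom x (b, c) ->
    mpath_dom x (a, c).
  rewrite /mpath_dom /=; case: (mpathP x) => s [sP sI [f _ [xf x0]]].
  move=> xab xbc.
  have [|/x0//] := pselect (Omega_set P s (a, b)) => -[/= aP _ ab _].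
  have [|/x0//] := pselect (Omega_set P s (b, c)) => -[/= _ cP bc cs].
  have Hac : Omega_set P s (a, c) by split=> //; exact: ple_trans bc.
  by rewrite (xf (exist _ _ Hac)).
rewrite /mpath_adom /=; split.
  have m1 : ple P 1 m by exists m; rewrite ?mul1g.
  have mn : ple P m (m * n) by exists n.
  move=> /(dom1 _ _ _ mn m1 gpred1 mP)[H1 H2]; exists H1.
  by rewrite /mpath_dom /= /mpath_shift /= gpred1 nP mulg1.
move=> [H1]; rewrite /mpath_dom /= /mpath_shift /= gpred1 nP mulg1 /=.
exact: dom2.
Qed.
Next Obligation.
move=> m n x H H' H''; apply: mpath_eq => -[p q] /=; rewrite /mpath_shift /=.
case: ifP => // /andP[pP qP].
have nP : n \in P by have [] := mpath_dom_sub H'.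
have npP : n * p \in P by exact: gpredM.
have nqP : n * q \in P by exact: gpredM.
by rewrite /mpath_shift /= npP nqP /= !mulgA.
Qed.

End MorphismPaths.

Section FilterPaths.
Variables (Q : groupType) (P : umagmaClosed Q) (C : Pgraph P).

Definition is_filter_path (x : set C) : Prop :=
  [/\ x !=set0,
      forall l m, preceq l m -> x m -> x l
    & forall m n, x m -> x n -> exists l, [/\ x l, preceq m l & preceq n l]].

Record filter_path := FilterPath {
  fpath_set :> set C;
  fpathP : is_filter_path fpath_set
}.

Lemma fpath_eq (x y : filter_path) : (x : set C) = y -> x = y.
Proof.
case: x y => x hx [y hy] /= e; subst y.
by rewrite (Prop_irrelevance hx hy).
Qed.

Definition fpath_basic (K : set C * set C) : set filter_path :=
  [set x | K.1 `<=` x /\ (x : set C) `<=` ~` K.2].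

HB.instance Definition _ := gen_eqMixin filter_path.
HB.instance Definition _ := gen_choiceMixin filter_path.

Let D : set (set C * set C) := [set K | finite_set K.1 /\ finite_set K.2].

Let fpath_basic_cover : \bigcup_(K in D) fpath_basic K = setT.
Proof.
apply/seteqP; split=> // x _; exists (set0, set0); first by split.
by split=> // l _ [].
Qed.

Let fpath_basic_join K L x : D K -> D L -> fpath_basic K x ->
  fpath_basic L x ->
  exists M, [/\ D M, fpath_basic M x
              & fpath_basic M `<=` fpath_basic K `&` fpath_basic L].
Proof.
move=> [K1 K2] [L1 L2] [xK1 xK2] [xL1 xL2].
exists (K.1 `|` L.1, K.2 `|` L.2); split.
- by split; rewrite /= finite_setU.
- split=> /= [l [/xK1|/xL1] //|l xl [|]]; [exact: xK2 | exact: xL2].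
- move=> y [/= y1 y2]; split; split=> l.
  + by move=> ?; apply: y1; left.
  + by move=> /y2 h ?; apply: h; left.
  + by move=> ?; apply: y1; right.
  + by move=> /y2 h ?; apply: h; right.
Qed.

HB.instance Definition _ :=
  isBaseTopological.Build filter_path fpath_basic_cover fpath_basic_join.

Definition fpath_adom (m : Q) : set filter_path :=
  [set x : filter_path | exists2 l, fpath_set x l & deg l = m].

(* As [deg] is injective on a filter, there is only one such [l]. *)
Definition fpath_shift (m : Q) (x : set C) : set C :=
  [set n | exists l k, [/\ x l, deg l = m, is_comp l n k & x k]].

Lemma is_comp_fun (l m k k' : C) : is_comp l m k -> is_comp l m k' -> k = k'.
Proof. by move=> [H <-] [H' <-]; rewrite (Prop_irrelevance H H'). Qed.

Lemma is_comp_rng (l : C) : is_comp (rng l) l l.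
Proof. by exists (src_rng l); exact: comp_rng. Qed.

Lemma is_comp_src (l : C) : is_comp l (src l) l.
Proof. by exists (esym (rng_src l)); exact: comp_src. Qed.

Lemma deg_src (l : C) : deg (src l) = 1.
Proof. by rewrite -rng_src deg_rng. Qed.

Lemma is_comp_deg (l m k : C) : is_comp l m k -> deg k = deg l * deg m.
Proof. by move=> [H <-]; exact: deg_comp. Qed.

Lemma is_comp_uniq (l m l' m' k : C) :
  is_comp l m k -> is_comp l' m' k -> deg l = deg l' -> l = l' /\ m = m'.
Proof.
move=> h h' e.
have [w [_ wu]] := pgraph_uf (deg_in l) (deg_in m) (is_comp_deg h).
have e' : deg m' = deg m.
  by apply: (mulgI (deg l)); rewrite {1}e -(is_comp_deg h) (is_comp_deg h').
have := wu (l', m') (And3 h' (esym e) e').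
by rewrite (wu (l, m) (And3 h erefl erefl)) => -[-> ->].
Qed.

Lemma is_compA (a b ab c abc : C) : is_comp a b ab -> is_comp ab c abc ->
  exists2 bc, is_comp b c bc & is_comp a bc abc.
Proof.
move=> [H1 <-] [H3 <-].
have H2 : src b = rng c by rewrite -H3 src_comp.
have H4 : src a = rng (comp H2) by rewrite rng_comp.
by exists (comp H2); [exists H2 | exists H4; exact/esym/comp_assoc].
Qed.

Lemma is_compAV (a b bc c abc : C) : is_comp b c bc -> is_comp a bc abc ->
  exists2 ab, is_comp a b ab & is_comp ab c abc.
Proof.
move=> [H2 <-] [H4 <-].
have H1 : src a = rng b by rewrite H4 rng_comp.
have H3 : src (comp H1) = rng c by rewrite src_comp.
by exists (comp H1); [exists H1 | exists H3; exact: comp_assoc].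
Qed.

Lemma fpath_deg_inj (x : filter_path) (l m : C) :
  fpath_set x l -> fpath_set x m -> deg l = deg m -> l = m.
Proof.
case: (fpathP x) => _ _ dir xl xm e.
have [k [_ [a la] [b mb]]] := dir _ _ xl xm.
by have [] := is_comp_uniq la mb e.
Qed.

Lemma fpath_shift_subproof m x :
  fpath_adom m x -> is_filter_path (fpath_shift m x).
Proof.
case: (fpathP x) => _ her dir -[u xu du]; split.
- by exists (src u), u, u; split=> //; exact: is_comp_src.
- move=> a b [c ac] [l [k [xl dl lb xk]]].
  have [la hla hk] := is_compAV ac lb.
  by exists l, la; split=> //; apply: her xk; exists c.
- move=> a b [l [k [xl dl la xk]]] [l' [k' [xl' dl' lb xk']]].
  have e : l' = l by apply: (fpath_deg_inj xl' xl); rewrite dl dl'.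
  subst l'.
  have [z [xz [c kc] [c' kc']]] := dir _ _ xk xk'.
  have [ac hac hz] := is_compA la kc.
  have [bc hbc hz'] := is_compA lb kc'.
  have [_ e] := is_comp_uniq hz hz' erefl; subst bc.
  exists ac; split; [by exists l, z | by exists c | by exists c'].
Qed.

Definition fpath_act (m : Q) (x : filter_path) (H : fpath_adom m x) :
  filter_path := FilterPath (fpath_shift_subproof H).

Program Definition fpath_action : partial_action P filter_path :=
  @PartialAction Q P filter_path fpath_adom fpath_act _ _ _ _ _.
Next Obligation. by move=> m x [l _ <-]; exact: deg_in. Qed.
Next Obligation.
move=> x; case: (fpathP x) => -[l xl] her _.
exists (rng l); last exact: deg_rng.
by apply: her xl; exists l; exact: is_comp_rng.
Qed.
Next Obligation.
move=> x H; apply: fpath_eq; apply/seteqP; split=> n /=.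
  move=> [l [k [xl dl ln xk]]].
  have [e1 _] : rng l = l /\ l = src l.
    by apply: is_comp_uniq (is_comp_rng l) (is_comp_src l) _; rewrite deg_rng.
  have e : k = n.
    apply: (is_comp_fun ln); case: (ln) => H' _.
    have -> : l = rng n by rewrite -H' -e1 src_rng.
    exact: is_comp_rng.
  by rewrite -e.
move=> xn; case: (fpathP x) => _ her _.
exists (rng n), n; split=> //; last exact: is_comp_rng.
  by apply: her xn; exists n; exact: is_comp_rng.
exact: deg_rng.
Qed.
Next Obligation.
move=> m n x mP nP; split.
  move=> [k xk dk].
  have [[a b] [[/= ab da db] _]] := pgraph_uf mP nP dk.
  have xa : fpath_set x a.
    by case: (fpathP x) => _ her _; apply: her xk; exists b.
  have H : fpath_adom m x by exists a.
  by exists H; exists b => //; exists a, k.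
move=> [H [b [a [k [xa da ab xk]]] db]]; exists k => //.
by rewrite (is_comp_deg ab) da db.
Qed.
Next Obligation.
move=> m n x H [b0 xb0 db0] H''; apply: fpath_eq; apply/seteqP.
have her : forall l m, preceq l m -> fpath_set x m -> fpath_set x l
  by case: (fpathP x).
have mP : m \in P by case: (H) => l _ <-; exact: deg_in.
have nP : n \in P by rewrite -db0; exact: deg_in.
split=> c /=.
  move=> [l [k [xl dl lc xk]]].
  have [[a b] [[/= ab da db] _]] := pgraph_uf mP nP dl.
  have [bc hbc hk] := is_compA ab lc.
  have xa : fpath_set x a by apply: her xl; exists b.
  exists b, bc; split=> //; first by exists a, l.
  by exists a, k.
move=> [b [bc [[a [ab [xa da hab xab]]] db hbc [a' [k [xa' da' hk xk]]]]]].
have e : a' = a by apply: (fpath_deg_inj xa' xa); rewrite da da'.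
subst a'; have [ab' hab' hk'] := is_compAV hbc hk.
have e := is_comp_fun hab' hab; subst ab'.
by exists ab, k; split=> //; rewrite (is_comp_deg hab) da db.
Qed.

End FilterPaths.

(* Main.v *)
Require Import Defs.
From mathcomp Require Import all_boot all_classical topology.

(** A path [x] is determined by the morphisms [x(e, q)], because unique
factorisation of [x(e, q) = x(e, p) x(p, q)] recovers [x(p, q)].  Conversely, a
filter [F] is countable and directed, so it has a cofinal increasing sequence
[l_0, l_1, ...], and sending [(p, q)] to the unique [n] with [a n = l],
[deg a = p], [deg l = q] and [l \in F] defines a graph morphism on
[Omega_{P, (deg l_n)}] whose image is [F].  The basic open sets on both sides
are given by the same conditions on this image. *)

Set Implicit Arguments.
Unset Strict Implicit.
Unset Printing Implicit Defensive.

Local Open Scope classical_set_scope.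
Local Open Scope group_scope.

(** * Prefixes and degrees in a [P]-graph *)

Section Preceq.
Variables (Q : groupType) (P : umagmaClosed Q) (L : Pgraph P).
Implicit Types k l m : L.

Lemma preceq_refl l : preceq l l.
Proof. by exists (src l); exact: is_comp_src. Qed.

Lemma preceq_trans m l k : preceq l m -> preceq m k -> preceq l k.
Proof. by move=> [a la] [b mb]; have [c _] := is_compA la mb; exists c. Qed.

Lemma preceq_deg l m : preceq l m -> ple P (deg l) (deg m).
Proof. by move=> [a /is_comp_deg ->]; exists (deg a); [exact: deg_in|]. Qed.

Lemma is_comp_rng_src l m k : is_comp l m k -> src l = rng m.
Proof. by case. Qed.

Lemma is_comp_src_comp l m k : is_comp l m k -> src k = src m.
Proof. by case=> H <-; exact: src_comp. Qed.

Lemma preceq_of_deg l p : p \in P -> ple P p (deg l) ->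
  exists a b, is_comp a b l /\ deg a = p.
Proof.
move=> pP [q qP /esym e]; have [[a b] [[ab da _] _]] := pgraph_uf pP qP e.
by exists a, b.
Qed.

End Preceq.

Lemma ple1p (Q : groupType) (P : umagmaClosed Q) (p : Q) :
  p \in P -> ple P 1 p.
Proof. by exists p; rewrite ?mul1g. Qed.

(** * Path morphisms and the filters that they trace out *)

Section MorphismPathTheory.
Variables (Q : groupType) (P : umagmaClosed Q) (L : Pgraph P).
Implicit Types x y : morphism_path L.

Lemma mpath_deg x p q l : x (p, q) = Some l -> deg l = p^-1 * q.
Proof.
case: (mpathP x) => s [sP sI [f [_ _ _ fd] [xf x0]]] xpq.
have [H|/x0] := pselect (Omega_set P s (p, q)); last by rewrite xpq.
by move: xpq; rewrite (xf (exist _ _ H)) => -[<-]; rewrite fd.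
Qed.

(** Functoriality of [x] on [(a, c) = (a, b)(b, c)], put in terms of the partial function so that
    later factorisations need no elements of [Omega]. *)
Lemma mpath_split x a b c : a \in P -> b \in P -> ple P a b -> ple P b c ->
  mpath_dom x (a, c) ->
  exists l m k, [/\ x (a, b) = Some l, x (b, c) = Some m, x (a, c) = Some k
    & is_comp l m k].
Proof.
case: (mpathP x) => s [sP sI [f [fr fs fc _] [xf x0]]] aP bP ab bc.
have [Hac _|/x0//] := pselect (Omega_set P s (a, c)).
have [/= _ cP _ [k ck]] := Hac.
have Hab : Omega_set P s (a, b) by split=> //; exists k; exact: ple_trans ck.
have Hbc : Omega_set P s (b, c) by split=> //; exists k.
pose v : Omega P s := exist _ _ Hab; pose w : Omega P s := exist _ _ Hbc.
have H : src v = rng w by exact: Omega_eq.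
have H' : src (f v) = rng (f w) by rewrite -fs -fr H.
exists (f v), (f w), (f (exist _ _ Hac)).
split; rewrite -?(xf v) -?(xf w) -?(xf (exist _ _ Hac)) //.
exists H'; rewrite -(fc _ _ H); congr f; exact: Omega_eq.
Qed.

Lemma mpath_dom_source x p q : mpath_dom x (p, q) -> mpath_dom x (1, q).
Proof.
rewrite /mpath_dom /=; case: (mpathP x) => s [sP sI [f _ [xf x0]]].
have [[/= _ qP _ qs] _|/x0//] := pselect (Omega_set P s (p, q)).
have H : Omega_set P s (1, q) by split; rewrite /= ?gpred1//; exact: ple1p.
by rewrite (xf (exist _ _ H)).
Qed.

Lemma mpath_dom_directed x p q : mpath_dom x (1, p) -> mpath_dom x (1, q) ->
  exists r, [/\ mpath_dom x (1, r), ple P p r & ple P q r].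
Proof.
rewrite /mpath_dom /=; case: (mpathP x) => s [sP sI [f _ [xf x0]]].
have [[/= _ _ _ [i pi]] _|/x0//] := pselect (Omega_set P s (1, p)).
have [[/= _ _ _ [j qj]] _|/x0//] := pselect (Omega_set P s (1, q)).
have sI' i' j' : (i' <= j')%N -> ple P (s i') (s j').
  rewrite leq_eqVlt => /orP[/eqP->|/sI//]; exact: ple_refl.
have H : Omega_set P s (1, s (i + j)%N).
  split; rewrite /= ?gpred1//; first exact: ple1p.
  by exists (i + j)%N; exact: ple_refl.
(* The index [i + j] exceeds both [i] and [j], so the increasing sequence bounds [p] and [q]
   there. *)
exists (s (i + j)%N); split; first by rewrite (xf (exist _ _ H)).
- exact: ple_trans pi (sI' _ _ (leq_addr _ _)).
- exact: ple_trans qj (sI' _ _ (leq_addl _ _)).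
Qed.

Lemma mpath_eimageP x l : mpath_eimage x l <-> x (1, deg l) = Some l.
Proof.
split=> [[[p q] [_ /= ->] xl]|xl].
  by have := mpath_deg xl; rewrite invg1 mul1g => ->.
by exists (1, deg l) => //; split=> //; rewrite /mpath_dom /= xl.
Qed.

Lemma mpath_eimage_dom x q l : x (1, q) = Some l -> mpath_eimage x l.
Proof.
by move=> xl; exists (1, q) => //; split=> //; rewrite /mpath_dom /= xl.
Qed.

(** The right-hand side is the domain condition of the filter action, which gives (C2). *)
Lemma mpath_adomP x q :
  mpath_adom q x <-> exists2 l, mpath_eimage x l & deg l = q.
Proof.
rewrite /mpath_adom /mpath_dom /=.
split=> [|[l /mpath_eimageP xl <-]]; last by rewrite xl.
case e : (x (1, q)) => [l|//] _.
exists l; first exact: mpath_eimage_dom e.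
by rewrite (mpath_deg e) invg1 mul1g.
Qed.

(** Unique factorisation at degree [p] makes [x (p, q)] depend on the image alone. Injectivity of
    [mpath_eimage] follows, and the right-hand side is the model for [factor_of]. *)
Lemma mpath_factorP x p q n : x (p, q) = Some n <->
  exists a l, [/\ mpath_eimage x l, is_comp a n l, deg a = p & deg l = q].
Proof.
split=> [xn|[a [l [/mpath_eimageP xl an <- <-]]]].
  have xpq : mpath_dom x (p, q) by rewrite /mpath_dom /= xn.
  have [/= pP qP pq] := mpath_dom_sub xpq.
  have [a [m [l [xa xm xl aml]]]] :=
    mpath_split gpred1 pP (ple1p pP) pq (mpath_dom_source xpq).
  move: xm; rewrite xn => -[e]; subst m; exists a, l; split=> //.
  - exact: mpath_eimage_dom xl.
  - by rewrite (mpath_deg xa) invg1 mul1g.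
  - by rewrite (mpath_deg xl) invg1 mul1g.
have x1l : mpath_dom x (1, deg l) by rewrite /mpath_dom /= xl.
have al : preceq a l by exists n.
have [b [m [k [xb xm]]]] := mpath_split gpred1 (deg_in a) (ple1p (deg_in a))
  (preceq_deg al) x1l.
rewrite xl => -[<-] bm; rewrite xm; congr Some.
have db : deg b = deg a by rewrite (mpath_deg xb) invg1 mul1g.
by have [] := is_comp_uniq bm an db.
Qed.

Lemma mpath_eimage_inj x y : mpath_eimage x = mpath_eimage y -> x = y.
Proof.
move=> e; apply: mpath_eq => -[p q]; case xn : (x (p, q)) => [n|].
  by apply/esym/mpath_factorP; rewrite -e; exact/mpath_factorP.
case yn : (y (p, q)) => [n|//].
by rewrite -xn; apply/mpath_factorP; rewrite e; exact/mpath_factorP.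
Qed.

(** Heredity: splitting [x (1, deg m)] at [deg l] gives a prefix in the image, and uniqueness
    identifies it with [l]. Directedness comes from that of the domain. *)
Lemma mpath_eimage_filter x : is_filter_path (mpath_eimage x).
Proof.
split.
- have /(mpath_adomP x 1)[l xl _] : mpath_adom 1 x.
    exact: (adom1 (mpath_action L) x).
  by exists l.
- move=> l m [n ln] /mpath_eimageP xm.
  have x1m : mpath_dom x (1, deg m) by rewrite /mpath_dom /= xm.
  have lm : preceq l m by exists n.
  have [b [c [k [xb _]]]] := mpath_split gpred1 (deg_in l) (ple1p (deg_in l))
    (preceq_deg lm) x1m.
  rewrite xm => -[<-] bc.
  have db : deg b = deg l by rewrite (mpath_deg xb) invg1 mul1g.
  have [<- _] := is_comp_uniq bc ln db.
  exact: mpath_eimage_dom xb.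
- move=> m n /mpath_eimageP xm /mpath_eimageP xn.
  have [r [xr mr nr]] : exists r, [/\ mpath_dom x (1, r),
      ple P (deg m) r & ple P (deg n) r].
    by apply: mpath_dom_directed; rewrite /mpath_dom /= ?xm ?xn.
  have [a [b [k [xa _ xk ab]]]] :=
    mpath_split gpred1 (deg_in m) (ple1p (deg_in m)) mr xr.
  have [c [d [k' [xc _ xk' cd]]]] :=
    mpath_split gpred1 (deg_in n) (ple1p (deg_in n)) nr xr.
  move: xa xc xk'; rewrite xm xn xk => -[?] [?] [?]; subst a c k'.
  exists k; split; [exact: mpath_eimage_dom xk | by exists b | by exists d].
Qed.

(** At [(1, deg n)] the shifted path takes the value [x (m, m * deg n)], which [mpath_factorP]
    expresses by the formula for the shifted filter. *)
Lemma mpath_eimage_act m x (H : mpath_adom m x) :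
  mpath_eimage (mpath_act H) = fpath_shift m (mpath_eimage x).
Proof.
have /mpath_adomP[l xl dl] := H; apply/seteqP; split=> n.
  move=> /mpath_eimageP /=; rewrite /mpath_shift /= gpred1 deg_in /= mulg1.
  move=> /mpath_factorP[a [k [xk an da dk]]]; exists a, k; split=> //.
  by have [_ her _] := mpath_eimage_filter x; apply: her xk; exists n.
move=> [a [k [xa da an xk]]]; apply/mpath_eimageP.
rewrite /= /mpath_shift /= gpred1 deg_in /= mulg1.
by apply/mpath_factorP; exists a, k; rewrite (is_comp_deg an) da.
Qed.

End MorphismPathTheory.

(** * The path morphism built from a filter *)

Section PathOfFilter.
Variables (Q : groupType) (P : umagmaClosed Q) (L : Pgraph P).
Variable F : filter_path L.

Lemma fpath_hereditary l m : preceq l m -> fpath_set F m -> fpath_set F l.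
Proof. by case: (Defs.fpathP F) => _ her _; exact: her. Qed.

Lemma fpath_cofinal_seq : exists u : nat -> L,
  [/\ forall n, fpath_set F (u n),
      forall i j, (i <= j)%N -> preceq (u i) (u j)
    & forall l, fpath_set F l -> exists n, preceq l (u n)].
Proof.
have [[l0 Fl0] _ dir] := Defs.fpathP F.
have /countable_injP[c cI] := pgraph_countable L.
(* Stage [nl.1] moves above the element of [F] with code [nl.1], if there is one. The premise sits
   under the existential so that choice yields a total function; outside [F] its value is
   arbitrary. *)
have step (nl : nat * L) : exists m, fpath_set F nl.2 ->
    [/\ fpath_set F m, preceq nl.2 m
      & forall k, fpath_set F k -> c k = nl.1 -> preceq k m].
  case: nl => n l /=.
  have [Fl|nFl] := pselect (fpath_set F l); last by exists l.
  have [[k [Fk ck]]|nk] := pselect (exists k, fpath_set F k /\ c k = n).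
    have [m [Fm lm km]] := dir _ _ Fl Fk.
    exists m => _; split=> // k' _ ck'.
    by rewrite (cI k' k) ?inE // ck' ck.
  exists l => _; split=> //; first exact: preceq_refl.
  by move=> k Fk ck; case: nk; exists k.
have [g gP] := choice step.
pose u := fix u n := if n is n'.+1 then g (n', u n') else l0.
have Fu n : fpath_set F (u n) by elim: n => //= n /(gP (n, u n))[].
exists u; split=> //.
  apply: homo_leq; [exact: preceq_refl | exact: preceq_trans |].
  by move=> n; have [] := gP (n, u n) (Fu n).
(* The passage from [u (c l)] to the next term is the one that deals with code [c l]. *)
move=> l Fl; exists (c l).+1.
by have [_ _] := gP (c l, u (c l)) (Fu _); exact.
Qed.

(** The characterisation in [mpath_factorP] with [F] in place of the image, hence the only possible
    value of the path at [pq]. *)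
Definition factor_of (pq : Q * Q) (n : L) : Prop :=
  exists a l, [/\ fpath_set F l, is_comp a n l, deg a = pq.1 & deg l = pq.2].

(** Degrees are injective on [F], so [pq.2] fixes [l]; unique factorisation at [pq.1] then fixes the
    remaining factor. *)
Lemma factor_of_uniq pq n n' : factor_of pq n -> factor_of pq n' -> n = n'.
Proof.
move=> [a [l [Fl an da dl]]] [a' [l' [Fl' an' da' dl']]].
have e : l' = l by apply: (fpath_deg_inj Fl' Fl); rewrite dl dl'.
subst l'; have da'a : deg a = deg a' by rewrite da da'.
by have [] := is_comp_uniq an an' da'a.
Qed.

Lemma factor_of_rng p q n : factor_of (p, q) n -> factor_of (p, p) (rng n).
Proof.
move=> [a [l [Fl an da dl]]]; exists a, a; split=> //.
  by apply: fpath_hereditary Fl; exists n.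
by rewrite -(is_comp_rng_src an); exact: is_comp_src.
Qed.

Lemma factor_of_src p q n : factor_of (p, q) n -> factor_of (q, q) (src n).
Proof.
move=> [a [l [Fl an da dl]]]; exists l, l; split=> //.
by rewrite -(is_comp_src_comp an); exact: is_comp_src.
Qed.

Lemma factor_of_comp p q r m n k : factor_of (p, q) m -> factor_of (q, r) n ->
  is_comp m n k -> factor_of (p, r) k.
Proof.
move=> [a [l [Fl am da dl]]] [b [l' [Fl' bn db dl']]] mn.
have Fb : fpath_set F b by apply: fpath_hereditary Fl'; exists n.
have e : b = l by apply: (fpath_deg_inj Fb Fl); rewrite db dl.
subst b; have [k' mk' ak'] := is_compA am bn.
by rewrite -(is_comp_fun mk' mn); exists a, l'.
Qed.

Lemma factor_of_deg p q n : factor_of (p, q) n -> deg n = p^-1 * q.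
Proof. by move=> [a [l [_ /is_comp_deg e /= <- <-]]]; rewrite e mulKg. Qed.

Definition path_of_filter (pq : Q * Q) : option L :=
  if pselect (exists n, factor_of pq n) is left e then Some (sval (cid e))
  else None.

Lemma path_of_filterP pq n : path_of_filter pq = Some n <-> factor_of pq n.
Proof.
rewrite /path_of_filter; case: pselect => [e|ne]; split=> //.
- by move=> [<-]; case: (cid e).
- move=> h; congr Some; case: (cid e) => n' h' /=.
  exact: factor_of_uniq h' h.
- by move=> h; case: ne; exists n.
Qed.

Lemma path_of_filter_subproof : is_morphism_path path_of_filter.
Proof.
have [u [Fu u_le u_cof]] := fpath_cofinal_seq.
pose d n := deg (u n).
(* The degrees of the cofinal sequence give exactly the right domain: if [q] is below [d i], cut
   [u i] at [q] and the resulting prefix at [p]; conversely, cofinality puts [l] below some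
   [u i]. *)
have Hex (pq : Q * Q) :
    Omega_set P d pq <-> exists n, factor_of pq n.
  case: pq => p q; split=> [[/= pP qP pq [i qi]]|[n [a [l [Fl an /= da dl]]]]].
    have [l [b [lb dl]]] := preceq_of_deg qP qi.
    rewrite -dl in pq; have [a [n [an da]]] := preceq_of_deg pP pq.
    exists n, a, l; split=> //.
    by apply: fpath_hereditary (Fu i); exists b.
  have [i li] := u_cof _ Fl.
  split; rewrite /= -?da -?dl; [exact: deg_in | exact: deg_in | | ].
    by apply: preceq_deg; exists n.
  by exists i; exact: preceq_deg.
pose f (w : Omega P d) : L :=
  sval (cid ((Hex (sval w)).1 (svalP w))).
have fP w : factor_of (sval w) (f w) by rewrite /f; case: cid.
exists d; split=> [n /=|j k /ltnW /u_le jk|].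
- exact: deg_in.
- exact: preceq_deg.
exists f; last first.
  split=> [w|pq npq]; first by apply/path_of_filterP; exact: fP.
  case e : (path_of_filter pq) => [n|//].
  by case: npq; apply/Hex; exists n; exact/path_of_filterP.
(* Each functor law reduces to uniqueness of factors, since both sides are factors for the same
   pair. *)
split.
- move=> w; apply: factor_of_uniq (fP _) _.
  by case: w (fP w) => -[p q] H /factor_of_rng.
- move=> w; apply: factor_of_uniq (fP _) _.
  by case: w (fP w) => -[p q] H /factor_of_src.
- move=> v w H H'; apply: factor_of_uniq (fP _) _.
  have := fP v; have := fP w.
  have : is_comp (f v) (f w) (Defs.comp H') by exists H'.
  move: H (Defs.comp H'); case: {H'} v (f v) => -[p q] hv fv.
  case: w (f w) => -[q' r] hw fw H k vwk hfw hfv.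
  have e : q = q' by case: H.
  by subst q'; exact: factor_of_comp hfv hfw vwk.
- by move=> w; case: w (fP w) => -[p q] H /factor_of_deg.
Qed.

Definition mpath_of_filter : morphism_path L :=
  MorphismPath path_of_filter_subproof.

Lemma mpath_of_filterK : mpath_eimage mpath_of_filter = fpath_set F.
Proof.
apply/seteqP; split=> l.
  move=> /mpath_eimageP/path_of_filterP[a [k [Fk al /= da _]]].
  (* Since [a] has degree 1, comparing with the factorisation of [k] through [rng k] gives
     [l = k]. *)
  have e : deg a = deg (rng k) by rewrite da deg_rng.
  by have [_ ->] := is_comp_uniq al (is_comp_rng k) e.
move=> Fl; apply/mpath_eimageP/path_of_filterP.
by exists (rng l), l; split=> //; [exact: is_comp_rng | exact: deg_rng].
Qed.

End PathOfFilter.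

(** * Inverse maps, continuity and equivariance *)

Theorem theorem5p2 (Q : groupType) (P : umagmaClosed Q)
    (QP : weakly_quasi_lattice_ordered P) (L : Pgraph P)
    (FA : finitely_aligned L) :
  exists h_filter : forall x : morphism_path L,
      is_filter_path (mpath_eimage x),
    conjugacy (mpath_action L) (fpath_action L)
      (fun x : morphism_path L => FilterPath (h_filter x)).
Proof.
exists (@mpath_eimage_filter Q P L).
pose h (x : morphism_path L) := FilterPath (mpath_eimage_filter x).
have hK : cancel h (@mpath_of_filter Q P L).
  (* Injectivity of the image turns the right inverse into a left inverse. *)
  by move=> x; apply: mpath_eimage_inj; rewrite mpath_of_filterK.
have gK : cancel (@mpath_of_filter Q P L) h.
  by move=> F; apply: fpath_eq; exact: mpath_of_filterK.
split.
- exists (@mpath_of_filter Q P L); split=> //.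
  (* The preimage under [h] of the basic set of [K] is by definition the basic set of the same [K],
     so the same family [D'] serves. *)
  + apply/continuousP => A [D' D'sub <-].
    by exists D' => //; rewrite preimage_bigcup.
  + apply/continuousP => A [D' D'sub <-].
    exists D' => //; rewrite preimage_bigcup; apply: eq_bigcupr => K _.
    by apply/seteqP; split=> F; rewrite /= /mpath_basic /= mpath_of_filterK.
- move=> m mP; apply/seteqP; split=> [_ [x /mpath_adomP xm <-] //|F Fm].
  exists (mpath_of_filter F); last exact: gK.
  by apply/mpath_adomP; rewrite mpath_of_filterK.
- move=> m x Hx Hy _; apply: fpath_eq; exact: mpath_eimage_act.
Qed.
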